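(* Let $a,b$ be complex parameters. The following two univariate functions satisfy the same ordinary Fuchsian differential equation of order $2$: $$F_1(a;\,2b,\,a-b;\,1+b;\;x,\,x^2)\qquad\text{and}\qquad(1-x)^{-2a}\,{}_2F_1\!\left(a,\tfrac12;\;1+b;\;-\frac{4x}{(x-1)^2}\right).$$ The same equation is satisfied by each of the functions $$(1-x)^{-a}F_1\!\left(a;\,1-a,\,a-b;\,1+b;\;\frac{x}{x-1},\,-x\right),\qquad (1-x^2)^{-a}F_1\!\left(a;\,2b,\,1-a;\,1+b;\;\frac{x}{x+1},\,\frac{x^2}{x^2-1}\right),$$ $$F_1(a;\,2b,\,a-b;\,2a;\;1-x,\,1-x^2),\qquad x^{-a}F_1\!\left(a;\,a-b,\,a-b;\,2a;\;\frac{x-1}x,\,1-x\right),$$ $$x^{-a}F_1\!\left(a;\,a-b,\,a-b;\,1+a-2b;\;\frac1x,\,x\right),\qquad (x-1)^{-a}F_1\!\left(a;\,1-a,\,a-b;\,1+a-2b;\;\frac1{1-x},\,x+1\right),$$ $$x^{-b}(1-x)^{2b-2a}F_1\!\left(1-2b;\,a-b,\,a-b;\,1+a-2b;\;\frac1{1-x},\,\frac{x}{x-1}\right),$$ $$x^{-b}(1-x)^{1-2a}F_1(1-2b;\,a-b,\,1-a;\,1+a-2b;\;x+1,\,x).$$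
   Context: $(\alpha)_n=\alpha(\alpha+1)\cdots(\alpha+n-1)$. Appell's series $$F_1(a;b_1,b_2;c;x,y)=\sum_{n,m\ge 0}\frac{(a)_{n+m}(b_1)_n(b_2)_m}{(c)_{n+m}\,n!\,m!}x^ny^m$$ satisfies the rank 3 system $$x(1-x)F_{xx}+y(1-x)F_{xy}+(c-(a+b_1+1)x)F_x-b_1yF_y-ab_1F=0,$$ $$y(1-y)F_{yy}+x(1-y)F_{xy}+(c-(a+b_2+1)y)F_y-b_2xF_x-ab_2F=0,$$ $$(y-x)F_{xy}+b_2F_x-b_1F_y=0 .$$ ${}_2F_1(A,B;C;z)=\sum_n \frac{(A)_n(B)_n}{(C)_n n!}z^n$ satisfies Euler's equation $z(1-z)y''+(C-(A+B+1)z)y'-ABy=0$. An ODE is Fuchsian if it is linear, homogeneous, with only regular singularities. Univariate specialization: for a holomorphic map $\Phi:t\mapsto(x(t),y(t))$ from an open subset of $\mathbf C$ to $\mathbf C^2$, $F(x(t),y(t))=F\circ\Phi$. An ODE in $t$ follows fully from a PDE system $H$ under $\Phi$ if the expression obtained from it by replacing $t$-derivatives by partial derivatives via the chain rule ($\frac{dF}{dt}=\dot xF_x+\dot yF_y$, etc.) coincides with the expression obtained by substituting $x=x(t),y=y(t)$ into the coefficients of some PDE that follows from $H$ by algebraic and partial differentiation operations. The ODE satisfied by a univariate specialization of an Appell function (Appell's symbol denoting a local analytic solution of the corresponding PDE system where the series does not converge) is understood as one following fully from its PDE system. For a transformed function $\theta(x)\,f(\varphi(x))$, or $\theta(x)$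 times a specialization of $F_1$, the ODE meant is the corresponding pull-back followed by multiplication of solutions by $\theta$. *)

(* Defs.v *)
From HB Require Import structures.
From mathcomp Require Import all_boot all_order all_algebra.
From mathcomp Require Import fraction polyXY generic_quotient.
From mathcomp Require Import complex reals.
Set Implicit Arguments.
Unset Strict Implicit.
Unset Printing Implicit Defensive.
Import GRing.Theory.
Local Open Scope ring_scope.
Local Open Scope quotient_scope.

Notation "x %:F" := (FracField.tofrac x) : ring_scope.

Notation ratfun C := {fraction {poly C}}.

(* In the polyXY convention the outer variable 'X is x and the inner one 'Y is
   y. *)
Notation ratfun2 C := {fraction {poly {poly C}}}.

(* Extension to fractions, by the quotient rule, of a derivation d of A. *)
Definition frac_deriv (A : idomainType) (d : A -> A) (f : {fraction A}) :
    {fraction A} :=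
  let n := \n_(repr f) in let m := \d_(repr f) in
  (d n * m - n * d m)%:F / (m ^+ 2)%:F.

Section RationalFunctions.
Variable C : fieldType.

Definition rcst (c : C) : ratfun C := c%:P%:F.
Definition rvar : ratfun C := 'X%:F.
Definition rderiv : ratfun C -> ratfun C := frac_deriv (@deriv C).

Definition rcst2 (c : C) : ratfun2 C := c%:P%:P%:F.
Definition rvarx : ratfun2 C := 'X%:F.
Definition rvary : ratfun2 C := 'Y%:F.
Definition rderivx : ratfun2 C -> ratfun2 C := frac_deriv (@deriv {poly C}).
Definition rderivy : ratfun2 C -> ratfun2 C :=
  frac_deriv (map_poly (@deriv C)).

(* f o phi; independent of the representative of f when phi is not constant,
   and only meant for such phi. *)
Definition rcomp (phi f : ratfun C) : ratfun C :=
  (map_poly rcst \n_(repr f)).[phi] / (map_poly rcst \d_(repr f)).[phi].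

Definition eval2 (p : {poly {poly C}}) (X Y : ratfun C) : ratfun C :=
  (map_poly (map_poly rcst) p).[X, Y].

(* The rational function f of (x, y) is defined at the generic point of the
   curve t |-> (X(t), Y(t)), and f(X(t), Y(t)) = v(t). *)
Definition specializes_to (X Y : ratfun C) (f : ratfun2 C) (v : ratfun C) :=
  exists p q : {poly {poly C}},
    [/\ eval2 q X Y != 0, f = p%:F / q%:F & v = eval2 p X Y / eval2 q X Y].

Definition regular_at (alpha : C) (f : ratfun C) :=
  exists p q : {poly C}, q.[alpha] != 0 /\ f = p%:F / q%:F.

End RationalFunctions.

(* A linear homogeneous ODE \sum_k c_k(t) (d/dt)^k F = 0 is the polynomial in
   d/dt with coefficients c_k, so that its order is n when its size is n.+1.
   Coefficients are written to the left of the derivations; the product of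
   {poly _} is NOT the composition of operators. *)
Notation ode C := {poly ratfun C}.

(* Likewise 'X stands for d/dx and 'Y for d/dy: the coefficient of
   (d/dx)^i (d/dy)^j F in the linear PDE L is L`_i`_j. *)
Notation pde C := {poly {poly ratfun2 C}}.

(* Linear expressions in the partial derivatives of F with coefficients in t,
   indexed as the PDEs above. *)
Notation jet_expr C := {poly {poly ratfun C}}.

Section ODE.
Variable C : fieldType.
Implicit Types E : ode C.

Definition same_ode E E' := exists2 g : ratfun C, g != 0 & E = g *: E'.

(* The operator composition (d/dt) o E. *)
Definition ode_deriv E : ode C := map_poly (@rderiv C) E + 'X * E.

(* ODE of f(phi(t)) from that of f(z), through d/dz = (1/phi') d/dt. *)
Definition pullback (phi : ratfun C) E : ode C :=
  \sum_(k < size E) rcomp phi E`_k *: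
    iter k (fun L => (rderiv phi)^-1 *: ode_deriv L) 1.

(* The (multivalued) function \prod_i f_i ^ e_i, with f_i rational and e_i a
   constant, is the list of the pairs (f_i, e_i). *)
Definition powprod := seq (ratfun C * C).

Definition dlog (theta : powprod) : ratfun C :=
  \sum_(fe <- theta) rcst fe.2 * (rderiv fe.1 / fe.1).

(* ODE of theta F from that of F: the operator theta o E o theta^-1, in which
   theta o (d/dt) o theta^-1 = d/dt - theta'/theta. *)
Definition mul_solutions (theta : powprod) E : ode C :=
  \sum_(k < size E) E`_k *: iter k (fun L => ode_deriv L - dlog theta *: L) 1.

(* alpha is an ordinary point or a regular singularity: after normalization
   of the leading coefficient, the coefficient of the k-th derivative in an
   equation of order n has at most a pole of order n - k. *)
Definition at_most_regular_singular (alpha : C) E :=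
  forall k, (k < size E)%N ->
    regular_at alpha ((@rvar C - rcst alpha) ^+ ((size E).-1 - k)
                      * (E`_k / lead_coef E)).

(* The point at infinity is t = 0 after t |-> 1/t. *)
Definition fuchsian E :=
  [/\ E != 0, forall alpha, at_most_regular_singular alpha E
    & at_most_regular_singular 0 (pullback (@rvar C)^-1 E)].

Definition euler_ode (A B c : C) : ode C :=
  let z := @rvar C in
  (z * (1 - z)) *: 'X^2 + (rcst c - rcst (A + B + 1) * z) *: 'X
  - (rcst (A * B))%:P.

End ODE.

Section PDE.
Variable C : fieldType.
Implicit Types (L : pde C) (J : jet_expr C) (X Y : ratfun C) (E : ode C).

Definition pde_scale (f : ratfun2 C) L : pde C := f%:P%:P * L.
Definition pde_derivx L : pde C := map_poly (map_poly (@rderivx C)) L + 'X * L.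
Definition pde_derivy L : pde C := map_poly (map_poly (@rderivy C)) L + 'Y * L.

Inductive pde_follows (H : seq (pde C)) : pde C -> Prop :=
| PdeGen L of L \in H : pde_follows H L
| PdeZero : pde_follows H 0
| PdeAdd L1 L2 of pde_follows H L1 & pde_follows H L2 :
    pde_follows H (L1 + L2)
| PdeScale f L of pde_follows H L : pde_follows H (pde_scale f L)
| PdeDerivx L of pde_follows H L : pde_follows H (pde_derivx L)
| PdeDerivy L of pde_follows H L : pde_follows H (pde_derivy L).

(* d/dt of an expression, with d/dt (F_ij) = X' F_(i+1)j + Y' F_i(j+1). *)
Definition chain_deriv X Y J : jet_expr C :=
  map_poly (map_poly (@rderiv C)) J
  + (rderiv X)%:P%:P * ('X * J) + (rderiv Y)%:P%:P * ('Y * J).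

Definition chain_rule X Y E : jet_expr C :=
  \sum_(k < size E) (E`_k)%:P%:P * iter k (chain_deriv X Y) 1.

Definition follows_fully (H : seq (pde C)) X Y E :=
  exists2 L, pde_follows H L &
    forall i j, specializes_to X Y L`_i`_j (chain_rule X Y E)`_i`_j.

Definition appellF1_system (a b1 b2 c : C) : seq (pde C) :=
  let x := @rvarx C in let y := @rvary C in
  let k := @rcst2 C in let s := pde_scale in
  [:: s (x * (1 - x)) ('X ^+ 2) + s (y * (1 - x)) ('X * 'Y)
      + s (k c - k (a + b1 + 1) * x) 'X - s (k b1 * y) 'Y - s (k (a * b1)) 1;
      s (y * (1 - y)) ('Y ^+ 2) + s (x * (1 - y)) ('X * 'Y)
      + s (k c - k (a + b2 + 1) * y) 'Y - s (k b2 * x) 'X - s (k (a * b2)) 1;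
      s (y - x) ('X * 'Y) + s (k b2) 'X - s (k b1) 'Y].

(* E is an ODE satisfied by theta(t) F1(a; b1, b2; c; X(t), Y(t)). *)
Definition ode_of_F1 (theta : powprod C) (a b1 b2 c : C) X Y E :=
  exists2 E0, follows_fully (appellF1_system a b1 b2 c) X Y E0 &
    same_ode E (mul_solutions theta E0).

(* E is the ODE of theta(t) 2F1(A, B; c; phi(t)). *)
Definition ode_of_2F1 (theta : powprod C) (A B c : C) (phi : ratfun C) E :=
  same_ode E (mul_solutions theta (pullback phi (euler_ode A B c))).

End PDE.

(* Main.v *)
Require Import Defs.
From HB Require Import structures.
From mathcomp Require Import all_boot all_order all_algebra.
From mathcomp Require Import fraction polyXY generic_quotient.
From mathcomp Require Import complex reals ring.
Import GRing.Theory Num.Theory.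
Set Implicit Arguments.
Unset Strict Implicit.
Unset Printing Implicit Defensive.
Local Open Scope ring_scope.
Local Open Scope quotient_scope.
Local Open Scope complex_scope.

(* Along a curve (X(t), Y(t)), the second t-derivative of F involves F_xx, F_xy
   and F_yy with coefficients X'^2, 2X'Y' and Y'^2.  Each of these three
   derivatives is eliminated by one equation of the rank 3 system of F1, with
   multipliers g1 = X'^2/(X(1-X)), g2 = Y'^2/(Y(1-Y)) and a g3 determined by
   F_xy.  What remains are the coefficients of F_x, F_y and F: an equation
   F'' + e1 F' + e0 F = 0 follows when two expressions for e1 agree.  They do
   on each of the nine curves, and after multiplication of the solutions by
   theta all of them, as well as the pull-back of Euler's equation, give

     F'' + ((1+b)/x + 2(a-b)/(x+1) + 2a/(x-1)) F'
         + 2a/(x-1) (b/x + 2(a-b)/(x+1)) F = 0.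

   The multipliers g_i, rational in t, are restrictions to the curve of rational
   functions of (x, y) because t is a Moebius function of X(t). *)

(** * Extension of a derivation to the field of fractions *)

Section FracDeriv.
Variable A : idomainType.

Lemma fracE (f : {fraction A}) : f = (\n_(repr f))%:F / (\d_(repr f))%:F.
Proof.
have dn0 := denom_ratioP (repr f).
apply: (mulIf (x := (\d_(repr f))%:F)); first by rewrite tofrac_eq0.
rewrite divfK ?tofrac_eq0 // -{1}[f]reprK.
rewrite !piE; apply/eqmodP => /=.
rewrite FracField.equivfE /FracField.mulf !numden_Ratio ?oner_neq0 ?mulr1 //.
by rewrite mulrC.
Qed.

Lemma fracP (f : {fraction A}) : exists p q : A, q != 0 /\ f = p%:F / q%:F.
Proof.
exists (\n_(repr f)), (\d_(repr f)).
by split; [exact: denom_ratioP | exact: fracE].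
Qed.

Lemma eq_fracE (p q p' q' : A) : q != 0 -> q' != 0 ->
  (p%:F / q%:F == p'%:F / q'%:F) = (p * q' == p' * q).
Proof.
by move=> q0 q'0; rewrite eqr_div ?tofrac_eq0 // -!tofracM tofrac_eq.
Qed.

Variable d : A -> A.
Hypothesis dM : forall p q, d (p * q) = d p * q + p * d q.

(** Two representations of one fraction satisfy n q = p m. Applying [d] to this identity with the
    Leibniz rule shows that the quotient rule does not depend on the representation. *)
Lemma frac_deriv_div (p q : A) : q != 0 ->
  frac_deriv d (p%:F / q%:F) = (d p * q - p * d q)%:F / (q ^+ 2)%:F.
Proof.
move=> q0; rewrite /frac_deriv.
set f := p%:F / q%:F; set n := \n_(repr f); set m := \d_(repr f).
have m0 : m != 0 := denom_ratioP (repr f).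
have e : n * q = p * m.
  apply/eqP; rewrite -(@eq_fracE n m p q) //; exact/eqP/esym/fracE.
have de := congr1 d e; rewrite !dM in de.
apply/eqP; rewrite eq_fracE ?expf_neq0 //; apply/eqP.
(* The left side is regrouped around n q and its derivative, which [e] and [de] express through p
   and m. *)
have -> : (d n * m - n * d m) * q ^+ 2 =
   m * q * (d n * q + n * d q) - m * d q * (n * q) - d m * q * (n * q) by ring.
by rewrite de e; ring.
Qed.

Hypothesis dD : forall p q, d (p + q) = d p + d q.

Lemma frac_derivD f g :
  frac_deriv d (f + g) = frac_deriv d f + frac_deriv d g.
Proof.
have [p [q [q0 ->]]] := fracP f; have [r [s [s0 ->]]] := fracP g.
rewrite addf_div ?tofrac_eq0 // -!tofracM -tofracD.
rewrite !frac_deriv_div ?mulf_neq0 //.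
rewrite addf_div ?tofrac_eq0 ?expf_neq0 // -!tofracM -tofracD -exprMn.
by congr (_%:F / _); rewrite dD !dM; ring.
Qed.

Lemma frac_derivM f g :
  frac_deriv d (f * g) = frac_deriv d f * g + f * frac_deriv d g.
Proof.
have [p [q [q0 ->]]] := fracP f; have [r [s [s0 ->]]] := fracP g.
rewrite mulf_div -!tofracM !frac_deriv_div ?mulf_neq0 // !mulf_div -!tofracM.
rewrite addf_div ?tofrac_eq0 ?mulf_neq0 ?expf_neq0 // -!tofracM -tofracD.
apply/eqP; rewrite eq_fracE ?mulf_neq0 ?expf_neq0 ?mulf_neq0 //; apply/eqP.
by rewrite !dM; ring.
Qed.

End FracDeriv.

(** * Derivations of a field *)

Definition derivation (K : fieldType) (D : K -> K) :=
  (forall f g, D (f + g) = D f + D g)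
  /\ (forall f g, D (f * g) = D f * g + f * D g).

Section Derivation.
Variables (K : fieldType) (D : K -> K).
Hypothesis derD : derivation D.

Lemma derivationD f g : D (f + g) = D f + D g.
Proof. by case: derD. Qed.

Lemma derivationM f g : D (f * g) = D f * g + f * D g.
Proof. by case: derD. Qed.

Lemma derivation0 : D 0 = 0.
Proof. by apply: (addrI (D 0)); rewrite -derivationD !addr0. Qed.

Lemma derivation1 : D 1 = 0.
Proof.
apply: (addrI (D 1)); rewrite addr0.
by rewrite -{3}[1]mulr1 derivationM mulr1 mul1r.
Qed.

Lemma derivationN f : D (- f) = - D f.
Proof. by apply/eqP; rewrite -addr_eq0 -derivationD addNr derivation0. Qed.

Lemma derivation_nat n : D n%:R = 0.
Proof.
elim: n => [|n IHn]; first exact: derivation0.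
by rewrite -addn1 natrD derivationD IHn derivation1 addr0.
Qed.

(** For nonzero f, differentiate f f^-1 = 1. At f = 0 both sides vanish because the inverse of 0 is
    0. *)
Lemma derivationV f : D f^-1 = - D f / f ^+ 2.
Proof.
have [->|f0] := eqVneq f 0; first by rewrite invr0 derivation0 oppr0 mul0r.
have := derivationM f f^-1; rewrite mulfV // derivation1 => /esym/eqP.
rewrite addrC addr_eq0 => /eqP e; apply: (mulfI f0); rewrite e.
by rewrite mulNr mulrN expr2 invfM mulrCA mulVKf.
Qed.

Lemma derivationX2 f : D (f ^+ 2) = 2 * f * D f.
Proof. by rewrite expr2 derivationM; ring. Qed.

Lemma derivationX3 f : D (f ^+ 3) = 3 * f ^+ 2 * D f.
Proof. by rewrite !exprS expr0 !derivationM derivation1; ring. Qed.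

End Derivation.

(** * Differentiation of rational functions of t *)

Section RDeriv.
Variable C : fieldType.
Implicit Types (f g : ratfun C) (u v : C).
Notation D := (@rderiv C).

Lemma rderiv_derivation : derivation D.
Proof.
by split=> f g; [apply: frac_derivD | apply: frac_derivM] => p q;
  rewrite ?derivM ?derivD.
Qed.

Lemma rderivD f g : D (f + g) = D f + D g.
Proof. exact: derivationD rderiv_derivation f g. Qed.

Lemma rderivM f g : D (f * g) = D f * g + f * D g.
Proof. exact: derivationM rderiv_derivation f g. Qed.

Lemma rderiv0 : D 0 = 0.
Proof. exact: derivation0 rderiv_derivation. Qed.

Lemma rderiv1 : D 1 = 0.
Proof. exact: derivation1 rderiv_derivation. Qed.

Lemma rderivN f : D (- f) = - D f.
Proof. exact: derivationN rderiv_derivation f. Qed.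

(** The resulting instance lets [rderiv] serve as the additive map [D] of [chain_jet2]. *)
Lemma rderiv_is_zmod_morphism : zmod_morphism D.
Proof. by move=> f g; rewrite rderivD rderivN. Qed.

HB.instance Definition _ :=
  GRing.isZmodMorphism.Build (ratfun C) (ratfun C) D rderiv_is_zmod_morphism.

Lemma rderiv_tofrac (p : {poly C}) : D p%:F = (p^`())%:F.
Proof.
rewrite -[p%:F]divr1 -tofrac1 /rderiv frac_deriv_div ?oner_neq0 //.
  by rewrite derivC mulr0 subr0 mulr1 expr1n tofrac1 divr1.
by move=> r s; rewrite derivM.
Qed.

Lemma rderiv_cst u : D (rcst u) = 0.
Proof. by rewrite /rcst rderiv_tofrac derivC tofrac0. Qed.

Lemma rderiv_var : D (rvar C) = 1.
Proof. by rewrite /rvar rderiv_tofrac derivX tofrac1. Qed.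

HB.instance Definition _ := GRing.RMorphism.copy (@rcst C)
  (@FracField.tofrac {poly C} \o polyC).

(* Unlike the rmorph lemmas, these leave terms syntactically of the form
   [rcst u], which matters because unification up to conversion is intractable
   on fractions of polynomials. *)
Lemma rcst0 : rcst 0 = 0 :> ratfun C. Proof. exact: rmorph0. Qed.

Lemma rcst1 : rcst 1 = 1 :> ratfun C. Proof. exact: rmorph1. Qed.

Lemma rcstD u v : rcst (u + v) = rcst u + rcst v.
Proof. exact: rmorphD. Qed.

Lemma rcstN u : rcst (- u) = - rcst u. Proof. exact: rmorphN. Qed.

Lemma rcstM u v : rcst (u * v) = rcst u * rcst v.
Proof. exact: rmorphM. Qed.

Lemma rcstV u : rcst u^-1 = (rcst u)^-1. Proof. exact: fmorphV. Qed.

Lemma rcst_nat n : rcst n%:R = n%:R :> ratfun C. Proof. exact: rmorph_nat. Qed.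

Definition rcstE := (rcst0, rcst1, rcst_nat, rcstD, rcstN, rcstM, rcstV).

Lemma rvarB_neq0 u : rvar C - rcst u != 0.
Proof. by rewrite -tofracB tofrac_eq0 polyXsubC_eq0. Qed.

Lemma rvar_neq0 : rvar C != 0.
Proof. by have := rvarB_neq0 0; rewrite rcst0 subr0. Qed.

Lemma rvar_neq1 : rvar C - 1 != 0.
Proof. by have := rvarB_neq0 1; rewrite rcst1. Qed.

Lemma rvar_neqN1 : rvar C + 1 != 0.
Proof. by have := rvarB_neq0 (-1); rewrite rcstN rcst1 opprK. Qed.

End RDeriv.

(** * Restriction of rational functions of (x, y) to a curve *)

Section Specialization.
Variables (C : fieldType) (X Y : ratfun C).
Local Notation ev p := (eval2 p X Y).

Lemma eval2D p q : ev (p + q) = ev p + ev q.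
Proof. by rewrite /eval2 rmorphD !hornerE. Qed.

Lemma eval2N p : ev (- p) = - ev p.
Proof. by rewrite /eval2 rmorphN !hornerE. Qed.

Lemma eval2M p q : ev (p * q) = ev p * ev q.
Proof. by rewrite /eval2 rmorphM !hornerE. Qed.

Lemma eval20 : ev 0 = 0.
Proof. by rewrite /eval2 rmorph0 !hornerE. Qed.

Lemma eval21 : ev 1 = 1.
Proof. by rewrite /eval2 rmorph1 !hornerE. Qed.

Local Notation sp := (specializes_to X Y).

Lemma eval2_neq0 q : ev q != 0 -> q != 0.
Proof. by apply: contraNneq => ->; rewrite eval20. Qed.

Lemma specializes_poly (p : {poly {poly C}}) : sp p%:F (ev p).
Proof. by exists p, 1; rewrite eval21 oner_neq0 tofrac1 !divr1. Qed.

Lemma specializes_varx : sp (rvarx C) X.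
Proof. by have := specializes_poly 'X; rewrite /eval2 map_polyX !hornerE. Qed.

Lemma specializes_vary : sp (rvary C) Y.
Proof.
have := specializes_poly 'Y.
by rewrite /eval2 map_polyC /= map_polyX !hornerE.
Qed.

Lemma specializes_cst c : sp (rcst2 c) (rcst c).
Proof.
have := specializes_poly c%:P%:P.
by rewrite /eval2 map_polyC /= map_polyC !hornerE.
Qed.

Lemma specializes1 : sp 1 1.
Proof. by have := specializes_poly 1; rewrite eval21 tofrac1. Qed.

Lemma specializes0 : sp 0 0.
Proof. by have := specializes_poly 0; rewrite eval20 tofrac0. Qed.

Lemma specializesD f v g w : sp f v -> sp g w -> sp (f + g) (v + w).
Proof.
move=> [p [q [q0 -> ->]]] [r [s [s0 -> ->]]].
have qF : q%:F != 0 by rewrite tofrac_eq0 (eval2_neq0 q0).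
have sF : s%:F != 0 by rewrite tofrac_eq0 (eval2_neq0 s0).
exists (p * s + r * q), (q * s); rewrite eval2D !eval2M tofracD !tofracM.
by rewrite (mulf_neq0 q0 s0) (addf_div _ _ qF sF) (addf_div _ _ q0 s0).
Qed.

Lemma specializesM f v g w : sp f v -> sp g w -> sp (f * g) (v * w).
Proof.
move=> [p [q [q0 -> ->]]] [r [s [s0 -> ->]]].
exists (p * r), (q * s); rewrite !eval2M !tofracM (mulf_neq0 q0 s0).
by rewrite !mulf_div.
Qed.

Lemma specializesN f v : sp f v -> sp (- f) (- v).
Proof.
by move=> [p [q [q0 -> ->]]]; exists (- p), q; rewrite q0 tofracN eval2N !mulNr.
Qed.

Lemma specializesB f v g w : sp f v -> sp g w -> sp (f - g) (v - w).
Proof. by move=> fv gw; apply: specializesD => //; apply: specializesN. Qed.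

(** A nonzero value on the curve means that the numerator does not vanish identically there, so
    numerator and denominator may be exchanged. *)
Lemma specializesV f v : v != 0 -> sp f v -> sp f^-1 v^-1.
Proof.
move=> v0 [p [q [q0 -> vE]]]; move: v0.
rewrite vE mulf_eq0 negb_or => /andP[p0 _].
by exists q, p; rewrite p0 !invf_div.
Qed.

(** Serves the coefficients in [coef_jet2], whose terms are multiplied by truth values selecting the
    monomial. *)
Lemma specializesMb f v (c : bool) : sp f v -> sp (f *+ c) (v *+ c).
Proof. by case: c => // _; apply: specializes0. Qed.

(* If t is a rational function on the curve, all of C(t) is. *)
Lemma specializes_surj tau : sp tau (rvar C) -> forall g, exists f, sp f g.
Proof.
move=> spt g; have [p [q [q0 ->]]] := fracP g.
have pol (r : {poly C}) : exists f, sp f r%:F.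
  elim/poly_ind: r => [|r c [f IHf]].
    by exists 0; rewrite tofrac0; apply: specializes0.
  exists (f * tau + rcst2 c); rewrite tofracD tofracM.
  by apply: specializesD (specializes_cst c); apply: specializesM.
have [f spf] := pol p; have [h sph] := pol q; exists (f * h^-1).
by apply: specializesM => //; apply: specializesV; rewrite ?tofrac_eq0.
Qed.

End Specialization.

(** * Expressions of order at most two in the partial derivatives *)

Section Monomials.
Variable K : comNzRingType.

(** The two digits in each argument's name count the derivations in x and in y. *)
Definition jet2 (c20 c11 c02 c10 c01 c00 : K) : {poly {poly K}} :=
  c20%:P%:P * 'X ^+ 2 + c11%:P%:P * ('X * 'Y) + c02%:P%:P * 'Y ^+ 2
  + c10%:P%:P * 'X + c01%:P%:P * 'Y + c00%:P%:P.

Lemma coef_monomial2 (c : K) i j k l :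
  (c%:P%:P * ('X^i * 'Y ^+ j))`_k`_l = c *+ ((k == i) && (l == j)).
Proof.
rewrite -polyC_exp coefCM coefMC coefXn coefCM.
by case: eqP => _; rewrite /= ?mul0r ?coef0 ?mulr0 // mul1r coefXn mulr_natr.
Qed.

Lemma coef_jet2 c20 c11 c02 c10 c01 c00 k l :
  (jet2 c20 c11 c02 c10 c01 c00)`_k`_l =
  c20 *+ ((k == 2) && (l == 0)) + c11 *+ ((k == 1) && (l == 1))
  + c02 *+ ((k == 0) && (l == 2)) + c10 *+ ((k == 1) && (l == 0))
  + c01 *+ ((k == 0) && (l == 1)) + c00 *+ ((k == 0) && (l == 0)).
Proof.
rewrite -!coef_monomial2 -!coefD.
by rewrite /jet2 !expr0 !expr1 !mulr1 !mul1r.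
Qed.

Lemma jet2P (p : {poly {poly K}}) c20 c11 c02 c10 c01 c00 :
  (forall k l, p`_k`_l =
    c20 *+ ((k == 2) && (l == 0)) + c11 *+ ((k == 1) && (l == 1))
    + c02 *+ ((k == 0) && (l == 2)) + c10 *+ ((k == 1) && (l == 0))
    + c01 *+ ((k == 0) && (l == 1)) + c00 *+ ((k == 0) && (l == 0))) ->
  p = jet2 c20 c11 c02 c10 c01 c00.
Proof.
by move=> e; apply/polyP => k; apply/polyP => l; rewrite e coef_jet2.
Qed.

End Monomials.

Lemma map_jet2 (K : comNzRingType) (D : {additive K -> K})
    c20 c11 c02 c10 c01 c00 :
  map_poly (map_poly D) (jet2 c20 c11 c02 c10 c01 c00) =
  jet2 (D c20) (D c11) (D c02) (D c10) (D c01) (D c00).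
Proof.
by apply: jet2P => k l; rewrite !coef_map /= coef_jet2 !raddfD !raddfMn.
Qed.

(** * Ordinary differential operators of order at most two *)

Section Ode2.
Variable K : fieldType.
Implicit Types e g : K.

Definition ode2 e2 e1 e0 : {poly K} := e2 *: 'X^2 + e1 *: 'X + e0%:P.

(** The default value 0 of [nth] accounts for all coefficients above the second. *)
Lemma coef_ode2 e2 e1 e0 k :
  (ode2 e2 e1 e0)`_k = nth 0 [:: e0; e1; e2] k.
Proof.
rewrite /ode2 !(coefD, coefZ, coefXn, coefX, coefC).
by case: k => [|[|[|k]]] /=; rewrite ?nth_nil !(mulr0, mulr1, addr0, add0r).
Qed.

Lemma ode2P (p : {poly K}) e2 e1 e0 :
  (forall k, p`_k = nth 0 [:: e0; e1; e2] k) -> p = ode2 e2 e1 e0.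
Proof. by move=> pE; apply/polyP => k; rewrite pE coef_ode2. Qed.

Lemma size_ode2 e2 e1 e0 : e2 != 0 -> size (ode2 e2 e1 e0) = 3%N.
Proof.
move=> e20; rewrite /ode2 -addrA size_polyDl ?size_scale ?size_polyXn //.
rewrite (leq_ltn_trans (size_polyD _ _)) // gtn_max.
rewrite (leq_ltn_trans (size_scale_leq _ _)) ?size_polyX //.
by rewrite (leq_ltn_trans (size_polyC_leq1 _)).
Qed.

Lemma lead_coef_ode2 e2 e1 e0 : e2 != 0 -> lead_coef (ode2 e2 e1 e0) = e2.
Proof. by move=> e20; rewrite /lead_coef size_ode2 // coef_ode2. Qed.

Lemma scale_ode2 g e2 e1 e0 :
  g *: ode2 e2 e1 e0 = ode2 (g * e2) (g * e1) (g * e0).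
Proof.
apply: ode2P => k; rewrite coefZ coef_ode2.
by case: k => [|[|[|k]]] //=; rewrite nth_nil mulr0.
Qed.

Lemma addr_ode2 e2 e1 e0 f2 f1 f0 :
  ode2 e2 e1 e0 + ode2 f2 f1 f0 = ode2 (e2 + f2) (e1 + f1) (e0 + f0).
Proof.
apply: ode2P => k; rewrite coefD !coef_ode2.
by case: k => [|[|[|k]]] //=; rewrite nth_nil addr0.
Qed.

Lemma ode2_1 : 1 = ode2 0 0 1 :> {poly K}.
Proof. by apply: ode2P => -[|[|[|k]]]; rewrite coefC //= nth_nil. Qed.

Lemma derivation_ode2 (D : K -> K) e1 e0 : D 0 = 0 ->
  map_poly D (ode2 0 e1 e0) + 'X * ode2 0 e1 e0 = ode2 e1 (D e1 + e0) (D e0).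
Proof.
move=> D0; apply: ode2P => k; rewrite coefD coef_map_id0 // coefXM !coef_ode2.
by case: k => [|[|[|[|k]]]] //=; rewrite ?nth_nil ?D0 ?addr0 ?add0r.
Qed.

(** The three operators on the left are the powers 0, 1 and 2 of d/dt - l, in the shape produced by
    iteration; [dl] stands for l'. *)
Lemma mul_solutions_sum e2 e1 e0 l dl :
  e0 *: ode2 0 0 1 + e1 *: ode2 0 1 (- l)
  + e2 *: ode2 1 (- l - l * 1) (- dl - l * - l) =
  ode2 e2 (e1 - 2 * l * e2) (e0 - e1 * l + e2 * (l ^+ 2 - dl)).
Proof. by rewrite !scale_ode2 !addr_ode2; congr ode2; ring. Qed.

(** Here the operators are the powers 0, 1 and 2 of r d/dt, with [dr] standing for r'. *)
Lemma pullback_sum e2 e1 e0 r dr :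
  e0 *: ode2 0 0 1 + e1 *: ode2 0 r 0 + e2 *: ode2 (r * r) (r * dr) 0 =
  ode2 (e2 * r ^+ 2) (e1 * r + e2 * r * dr) e0.
Proof. by rewrite !scale_ode2 !addr_ode2; congr ode2; ring. Qed.

End Ode2.

(** * Chain rule and combinations of Appell's equations *)

Section ChainRule.
Variable K : comNzRingType.
Variable D : {additive K -> K}.

Lemma addr_jet2 c20 c11 c02 c10 c01 c00 d20 d11 d02 d10 d01 d00 :
  jet2 c20 c11 c02 c10 c01 c00 + jet2 d20 d11 d02 d10 d01 d00 =
  jet2 (c20 + d20) (c11 + d11) (c02 + d02) (c10 + d10) (c01 + d01) (c00 + d00)
    :> {poly {poly K}}.
Proof. by rewrite /jet2 !polyCD; ring. Qed.

Lemma scale_jet2 (c c20 c11 c02 c10 c01 c00 : K) :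
  c%:P%:P * jet2 c20 c11 c02 c10 c01 c00 =
  jet2 (c * c20) (c * c11) (c * c02) (c * c10) (c * c01) (c * c00).
Proof. by rewrite /jet2 !polyCM; ring. Qed.

Lemma jet2_1 : 1 = jet2 0 0 0 0 0 1 :> {poly {poly K}}.
Proof. by rewrite /jet2 !polyC0 !mul0r !add0r. Qed.

(** This is the t-derivative of u F_x + v F_y + w F, with [X1] and [Y1] standing for X' and Y'.
    Starting from order one is enough to reach F''. *)
Lemma chain_jet2 (X1 Y1 u v w : K) :
  map_poly (map_poly D) (jet2 0 0 0 u v w)
  + X1%:P%:P * ('X * jet2 0 0 0 u v w) + Y1%:P%:P * ('Y * jet2 0 0 0 u v w) =
  jet2 (X1 * u) (Y1 * u + X1 * v) (Y1 * v) (D u + X1 * w) (D v + Y1 * w) (D w).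
Proof.
by rewrite map_jet2 raddf0 /jet2 !(polyCD, polyCM, polyC0); ring.
Qed.

Lemma chain_rule_sum (e2 e1 e0 X1 X2 Y1 Y2 : K) :
  e0%:P%:P * jet2 0 0 0 0 0 1
  + e1%:P%:P * jet2 0 0 0 X1 Y1 0
  + e2%:P%:P * jet2 (X1 * X1) (Y1 * X1 + X1 * Y1) (Y1 * Y1) X2 Y2 0 =
  jet2 (e2 * X1 ^+ 2) (e2 * (2 * X1 * Y1)) (e2 * Y1 ^+ 2)
    (e2 * X2 + e1 * X1) (e2 * Y2 + e1 * Y1) e0.
Proof. by rewrite !scale_jet2 !addr_jet2; congr jet2; ring. Qed.

(** The letters [a] and [b] stand for the coefficients a + b1 + 1 and a + b2 + 1 of Appell's system,
    and [ab1], [ab2] for the products a b1 and a b2. *)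
Lemma F1_combination (x y : K) g1 g2 g3 a b b1 b2 c ab1 ab2 :
  g1%:P%:P * ((x * (1 - x))%:P%:P * ('X ^+ 2) + (y * (1 - x))%:P%:P * ('X * 'Y)
      + (c - a * x)%:P%:P * 'X - (b1 * y)%:P%:P * 'Y - ab1%:P%:P * 1) +
  g2%:P%:P * ((y * (1 - y))%:P%:P * ('Y ^+ 2) + (x * (1 - y))%:P%:P * ('X * 'Y)
      + (c - b * y)%:P%:P * 'Y - (b2 * x)%:P%:P * 'X - ab2%:P%:P * 1) +
  g3%:P%:P * ((y - x)%:P%:P * ('X * 'Y) + b2%:P%:P * 'X - b1%:P%:P * 'Y) =
  jet2 (g1 * (x * (1 - x)))
   (g1 * (y * (1 - x)) + g2 * (x * (1 - y)) + g3 * (y - x))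
   (g2 * (y * (1 - y)))
   (g1 * (c - a * x) - g2 * (b2 * x) + g3 * b2)
   (g2 * (c - b * y) - g1 * (b1 * y) - g3 * b1)
   (- (g1 * ab1) - g2 * ab2).
Proof.
by rewrite /jet2 !(polyCD, polyCN, polyCB, polyCM); ring.
Qed.

End ChainRule.

Lemma mulf_neq0_inv (K : fieldType) (u v : K) : u * v != 0 -> u != 0 /\ v != 0.
Proof. by rewrite mulf_eq0 negb_or => /andP. Qed.

Lemma subr1_neq0 (K : fieldType) (u : K) : u - 1 != 0 -> 1 - u != 0.
Proof. by rewrite -oppr_eq0 opprB. Qed.

Lemma subrK_add (V : comNzRingType) (u v w : V) : v + w + (u - v - w) = u.
Proof. by ring. Qed.

(** To be read with u = q, v = e1 l, w = l^2 and z = l': passing from theta F to F and back restores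
    q. *)
Lemma addr_cancel4 (V : comNzRingType) (u v w z : V) :
  u + v - w + z - v + (w - z) = u.
Proof. by ring. Qed.

(** * Transformations of second order equations in closed form *)

Section Order2.
Variable C : fieldType.
Implicit Types e l X Y phi : ratfun C.
Notation D := (@rderiv C).

Lemma ode_deriv_ode2 e1 e0 :
  ode_deriv (ode2 0 e1 e0) = ode2 e1 (D e1 + e0) (D e0).
Proof. exact: (derivation_ode2 _ _ (rderiv0 C)). Qed.

(** With F = G/theta, the terms F' and F'' turn into G' - l G and G'' - 2l G' + (l^2 - l') G, up to
    the common factor 1/theta. *)
Lemma mul_solutions_ode2 theta e2 e1 e0 : e2 != 0 ->
  let l := dlog theta in
  mul_solutions theta (ode2 e2 e1 e0) =
  ode2 e2 (e1 - 2 * l * e2) (e0 - e1 * l + e2 * (l ^+ 2 - D l)).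
Proof.
move=> e20 l; rewrite /mul_solutions size_ode2 // !big_ord_recr big_ord0.
rewrite [in X in X = _]/= !coef_ode2 [in X in X = _]/= -/l add0r.
have step u v : ode_deriv (ode2 0 u v) - l *: ode2 0 u v =
    ode2 u (D u + v - l * u) (D v - l * v).
  by rewrite ode_deriv_ode2 -scaleNr scale_ode2 addr_ode2 mulr0 addr0 !mulNr.
rewrite ode2_1 step rderiv0 rderiv1 mulr0 add0r sub0r subr0 mulr1 step.
by rewrite rderiv1 rderivN add0r mul_solutions_sum.
Qed.

(** Since d/dz = r d/dt, the second derivative in z is r^2 (d/dt)^2 + r r' d/dt. *)
Lemma pullback_ode2 phi e2 e1 e0 : e2 != 0 ->
  let r := (D phi)^-1 in
  pullback phi (ode2 e2 e1 e0) =
  ode2 (rcomp phi e2 * r ^+ 2) (rcomp phi e1 * r + rcomp phi e2 * r * D r)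
    (rcomp phi e0).
Proof.
move=> e20 r; rewrite /pullback size_ode2 // !big_ord_recr big_ord0.
rewrite [in X in X = _]/= !coef_ode2 [in X in X = _]/= -/r add0r.
have step u v : r *: ode_deriv (ode2 0 u v) =
    ode2 (r * u) (r * (D u + v)) (r * D v).
  by rewrite ode_deriv_ode2 scale_ode2.
rewrite ode2_1 step rderiv0 rderiv1 mulr0 add0r mulr1 step rderiv0 addr0 mulr0.
by rewrite pullback_sum.
Qed.

Lemma chain_rule_ode2 X Y e2 e1 e0 : e2 != 0 ->
  chain_rule X Y (ode2 e2 e1 e0) =
  jet2 (e2 * D X ^+ 2) (e2 * (2 * D X * D Y)) (e2 * D Y ^+ 2)
    (e2 * D (D X) + e1 * D X) (e2 * D (D Y) + e1 * D Y) e0.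
Proof.
move=> e20; rewrite /chain_rule size_ode2 // !big_ord_recr big_ord0.
rewrite [in X in X = _]/= !coef_ode2 [in X in X = _]/= add0r.
have step u v w : chain_deriv X Y (jet2 0 0 0 u v w) =
  jet2 (D X * u) (D Y * u + D X * v) (D Y * v) (D u + D X * w) (D v + D Y * w)
    (D w) by exact: chain_jet2.
rewrite jet2_1 step rderiv0 rderiv1 !mulr0 !add0r !mulr1 step rderiv0.
by rewrite !mulr0 !addr0 chain_rule_sum.
Qed.

End Order2.

(* p and q are the coefficients of the equation of theta F, with l the
   logarithmic derivative of theta; the equation of F itself then has the
   coefficients e1 = p + 2 l and e0 = q + e1 l - l^2 + l'. *)
Definition F1_order2 (K : fieldType) (D : K -> K) (l a b1 b2 c X Y p q : K) :=
  let g1 := D X ^+ 2 / (X * (1 - X)) in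
  let g2 := D Y ^+ 2 / (Y * (1 - Y)) in
  let g3 :=
    (2 * D X * D Y - g1 * (Y * (1 - X)) - g2 * (X * (1 - Y))) / (Y - X) in
  let e1 := p + 2 * l in
  [/\ X * (1 - X) != 0, Y * (1 - Y) != 0 & Y - X != 0] /\
  [/\ D (D X) + e1 * D X =
        g1 * (c - (a + b1 + 1) * X) - g2 * (b2 * X) + g3 * b2,
      D (D Y) + e1 * D Y =
        g2 * (c - (a + b2 + 1) * Y) - g1 * (b1 * Y) - g3 * b1 &
      q + e1 * l - l ^+ 2 + D l = - (g1 * (a * b1)) - g2 * (a * b2)].

(* t is the image of X under the Moebius transformation with coefficients
   m1, ..., m4; w is the inverse of its denominator m3 X + m4. *)
Definition moebius (K : fieldType) (m1 m2 m3 m4 X w t : K) :=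
  (m3 * X + m4) * w = 1 /\ (m1 * X + m2) * w = t.

(** * Identities on the nine curves and for Euler's equation *)

Section Identities.
Variables (K : fieldType) (D : K -> K) (a b x : K).
Hypotheses (derD : derivation D) (Dx : D x = 1) (Da : D a = 0) (Db : D b = 0).
Hypotheses (x0 : x != 0) (xm : x - 1 != 0) (xp : x + 1 != 0).

Definition ode_coef1 : K :=
  (1 + b) / x + 2 * (a - b) / (x + 1) + 2 * a / (x - 1).

Definition ode_coef0 : K := 2 * a / (x - 1) * (b / x + 2 * (a - b) / (x + 1)).

Let dE := (derivationX2 derD, derivationX3 derD, derivationM derD,
  derivationV derD, derivationN derD, derivationD derD, derivation1 derD,
  derivation0 derD, derivation_nat derD, Dx, Da, Db).

Lemma units_neq0 (s : bool) i j k (u : K) :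
  u = (-1) ^+ s * x ^+ i * (x - 1) ^+ j * (x + 1) ^+ k -> u != 0.
Proof. by move=> ->; rewrite !mulf_neq0 ?expf_neq0 // oppr_eq0 oner_eq0. Qed.

(** On each of the nine curves X(1-X), Y(1-Y) and Y-X have this form, so none of them lies in the
    singular locus of the system. *)
Lemma units_div_neq0 (s : bool) i j k i' j' k' (u : K) :
  u = (-1) ^+ s * x ^+ i * (x - 1) ^+ j * (x + 1) ^+ k
      / (x ^+ i' * (x - 1) ^+ j' * (x + 1) ^+ k') -> u != 0.
Proof.
move=> ->; rewrite !mulf_neq0 ?invr_eq0 ?mulf_neq0 ?expf_neq0 //.
by rewrite oppr_eq0 oner_eq0.
Qed.

(* Every denominator that occurs is +- x^i (x-1)^j (x+1)^k; the exponents are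
   found by search. *)
Ltac nz1 s i j k := apply: (@units_neq0 s i j k); ring.
Ltac nzk s i j := first [nz1 s i j 0%N | nz1 s i j 1%N | nz1 s i j 2%N].
Ltac nzj s i := first [nzk s i 0%N | nzk s i 1%N | nzk s i 2%N].
Ltac nzi s := first [nzj s 0%N | nzj s 1%N | nzj s 2%N].
Ltac nz := first [done | nzi false | nzi true].
Ltac nzs :=
  rewrite ?x0 ?xm ?xp //=; rewrite ?andbT; repeat (apply/andP; split); nz.

Ltac nzd s i j k i' j' k' :=
  apply: (@units_div_neq0 s i j k i' j' k'); field; nzs.

Ltac identities := by split; rewrite ?dE /ode_coef1 /ode_coef0; field; nzs.

Lemma moebius_X : moebius 1 0 0 1 x 1 x.
Proof. by split; ring. Qed.

Lemma moebius_XdivXm1 : moebius 1 0 1 (-1) (x / (x - 1)) (x - 1) x.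
Proof. by split; field; rewrite ?x0 ?xm ?xp ?(subr1_neq0 xm). Qed.

Lemma moebius_XdivXp1 : moebius 1 0 (-1) 1 (x / (x + 1)) (x + 1) x.
Proof. by split; field; rewrite ?x0 ?xm ?xp ?(subr1_neq0 xm). Qed.

Lemma moebius_1mX : moebius (-1) 1 0 1 (1 - x) 1 x.
Proof. by split; ring. Qed.

Lemma moebius_Xm1divX : moebius 0 1 (-1) 1 ((x - 1) / x) x x.
Proof. by split; field; rewrite ?x0 ?xm ?xp ?(subr1_neq0 xm). Qed.

Lemma moebius_Xinv : moebius 0 1 1 0 (1 / x) x x.
Proof. by split; field; rewrite ?x0 ?xm ?xp ?(subr1_neq0 xm). Qed.

Lemma moebius_1mXinv : moebius 1 (-1) 1 0 (1 / (1 - x)) (1 - x) x.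
Proof. by split; field; rewrite ?x0 ?xm ?xp ?(subr1_neq0 xm). Qed.

Lemma moebius_Xp1 : moebius 1 (-1) 0 1 (x + 1) 1 x.
Proof. by split; ring. Qed.

Lemma F1_order2_X_X2 :
  F1_order2 D 0
    a (2 * b) (a - b) (1 + b) x (x ^+ 2) ode_coef1 ode_coef0.
Proof.
split; last identities.
(* The arguments are the sign ([true] for minus), then the exponents of x, x-1, x+1 in the numerator
   and in the denominator. Here the three quantities are -x(x-1), -x^2(x-1)(x+1) and x(x-1). *)
split; [nzd true 1%N 1%N 0%N 0%N 0%N 0%N
       | nzd true 2%N 1%N 1%N 0%N 0%N 0%N
       | nzd false 1%N 1%N 0%N 0%N 0%N 0%N].
Qed.

Lemma F1_order2_XdivXm1_NX :
  F1_order2 D (- a * (D (1 - x) / (1 - x)))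
    a (1 - a) (a - b) (1 + b) (x / (x - 1)) (- x) ode_coef1 ode_coef0.
Proof.
split; last identities.
split; [nzd true 1%N 0%N 0%N 0%N 2%N 0%N
       | nzd true 1%N 0%N 1%N 0%N 0%N 0%N
       | nzd true 2%N 0%N 0%N 0%N 1%N 0%N].
Qed.

Lemma F1_order2_XdivXp1_X2divX2m1 :
  F1_order2 D (- a * (D (1 - x ^+ 2) / (1 - x ^+ 2)))
    a (2 * b) (1 - a) (1 + b) (x / (x + 1)) (x ^+ 2 / (x ^+ 2 - 1))
    ode_coef1 ode_coef0.
Proof.
split; last identities.
split; [nzd false 1%N 0%N 0%N 0%N 0%N 2%N
       | nzd true 2%N 0%N 0%N 0%N 2%N 2%N
       | nzd false 1%N 0%N 0%N 0%N 1%N 1%N].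
Qed.

Lemma F1_order2_1mX_1mX2 :
  F1_order2 D 0
    a (2 * b) (a - b) (2 * a) (1 - x) (1 - x ^+ 2) ode_coef1 ode_coef0.
Proof.
split; last identities.
split; [nzd true 1%N 1%N 0%N 0%N 0%N 0%N
       | nzd true 2%N 1%N 1%N 0%N 0%N 0%N
       | nzd true 1%N 1%N 0%N 0%N 0%N 0%N].
Qed.

Lemma F1_order2_Xm1divX_1mX :
  F1_order2 D (- a * (D x / x))
    a (a - b) (a - b) (2 * a) ((x - 1) / x) (1 - x) ode_coef1 ode_coef0.
Proof.
split; last identities.
split; [nzd false 0%N 1%N 0%N 2%N 0%N 0%N
       | nzd true 1%N 1%N 0%N 0%N 0%N 0%N
       | nzd true 0%N 1%N 1%N 1%N 0%N 0%N].
Qed.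

Lemma F1_order2_Xinv_X :
  F1_order2 D (- a * (D x / x))
    a (a - b) (a - b) (1 + a - 2 * b) (1 / x) x ode_coef1 ode_coef0.
Proof.
split; last identities.
split; [nzd false 0%N 1%N 0%N 2%N 0%N 0%N
       | nzd true 1%N 1%N 0%N 0%N 0%N 0%N
       | nzd false 0%N 1%N 1%N 1%N 0%N 0%N].
Qed.

Lemma F1_order2_1mXinv_Xp1 :
  F1_order2 D (- a * (D (x - 1) / (x - 1)))
    a (1 - a) (a - b) (1 + a - 2 * b) (1 / (1 - x)) (x + 1) ode_coef1 ode_coef0.
Proof.
split; last identities.
split; [nzd true 1%N 0%N 0%N 0%N 2%N 0%N
       | nzd true 1%N 0%N 1%N 0%N 0%N 0%N
       | nzd false 2%N 0%N 0%N 0%N 1%N 0%N].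
Qed.

Lemma F1_order2_1mXinv_XdivXm1 :
  F1_order2 D (- b * (D x / x) + (2 * b - 2 * a) * (D (1 - x) / (1 - x)))
    (1 - 2 * b) (a - b) (a - b) (1 + a - 2 * b)
    (1 / (1 - x)) (x / (x - 1)) ode_coef1 ode_coef0.
Proof.
split; last identities.
split; [nzd true 1%N 0%N 0%N 0%N 2%N 0%N
       | nzd true 1%N 0%N 0%N 0%N 2%N 0%N
       | nzd false 0%N 0%N 1%N 0%N 1%N 0%N].
Qed.

Lemma F1_order2_Xp1_X :
  F1_order2 D (- b * (D x / x) + (1 - 2 * a) * (D (1 - x) / (1 - x)))
    (1 - 2 * b) (a - b) (1 - a) (1 + a - 2 * b) (x + 1) x ode_coef1 ode_coef0.
Proof.
split; last identities.
split; [nzd true 1%N 0%N 1%N 0%N 0%N 0%N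
       | nzd true 1%N 1%N 0%N 0%N 0%N 0%N
       | nzd true 0%N 0%N 0%N 0%N 0%N 0%N].
Qed.

(** The quadratic map z satisfies 1 - z = ((x+1)/(x-1))^2, so z(1-z), z' and r factor into powers of
    x, x-1 and x+1 up to constants. Division by the leading coefficient [e2] makes the transformed
    equation monic. *)
Lemma euler_pullback (two0 : 2 != 0 :> K)
    (z := - (4 * x / (x - 1) ^+ 2)) (r := (D z)^-1)
    (l := - (2 * a) * (D (1 - x) / (1 - x)))
    (e2 := z * (1 - z) * r ^+ 2)
    (e1 := (1 + b - (a + 1 / 2 + 1) * z) * r + z * (1 - z) * r * D r)
    (e0 := - (a * (1 / 2))) :
  [/\ z * (1 - z) != 0, D z != 0, e2 != 0,
      ode_coef1 = e2^-1 * (e1 - 2 * l * e2)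
    & ode_coef0 = e2^-1 * (e0 - e1 * l + e2 * (l ^+ 2 - D l))].
Proof.
have four0 : 4 != 0 :> K by rewrite (natrM _ 2 2) mulf_neq0.
have xn : 1 - x != 0 by rewrite -oppr_eq0 opprB.
(* Closed forms are computed first, which leaves only the known denominators in the last two
   identities. *)
have Dz : D z = 4 * (x + 1) / (x - 1) ^+ 3.
  by rewrite /z !dE; field; rewrite ?x0 ?xm.
have rE : r = (x - 1) ^+ 3 / (4 * (x + 1)).
  by rewrite /r Dz; field; rewrite ?xp ?xm ?four0.
have zE : z * (1 - z) = - 4 * x * (x + 1) ^+ 2 / (x - 1) ^+ 4.
  by rewrite /z; field; rewrite ?x0 ?xm.
have Dr : D r = (x - 1) ^+ 2 * (2 * x + 4) / (4 * (x + 1) ^+ 2).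
  by rewrite rE !dE; field; rewrite ?xp ?four0.
have e2E : e2 = - x * (x - 1) ^+ 2 / 4.
  by rewrite /e2 zE rE; field; rewrite ?x0 ?xm ?xp ?four0.
have e20 : e2 != 0.
  by rewrite e2E !mulf_neq0 ?invr_eq0 ?expf_neq0 ?oppr_eq0.
split; first by rewrite zE !mulf_neq0 ?invr_eq0 ?expf_neq0 ?oppr_eq0.
- by rewrite Dz !mulf_neq0 ?invr_eq0 ?expf_neq0.
- exact: e20.
- rewrite e2E /e1 zE Dr rE /l /z /ode_coef1 !dE; field; nzs.
- rewrite e2E /e1 /e0 zE Dr rE /l /z /ode_coef0 !dE; field; nzs.
Qed.

End Identities.

(** * Equations following fully from Appell's system *)

Section F1.
Variable C : fieldType.
Implicit Types X Y w p q l : ratfun C.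
Notation D := (@rderiv C).

Lemma specializes_moebius X Y w (m1 m2 m3 m4 : C) :
  moebius (rcst m1) (rcst m2) (rcst m3) (rcst m4) X w (rvar C) ->
  exists tau, specializes_to X Y tau (rvar C).
Proof.
move=> [dw nw].
(* The denominator of the Moebius function is invertible, with inverse [w]. *)
have [d0 _] : rcst m3 * X + rcst m4 != 0 /\ w != 0.
  by apply: mulf_neq0_inv; rewrite dw oner_neq0.
exists ((rcst2 m1 * rvarx C + rcst2 m2) / (rcst2 m3 * rvarx C + rcst2 m4)).
have lin m n :
    specializes_to X Y (rcst2 m * rvarx C + rcst2 n) (rcst m * X + rcst n).
  apply: specializesD; last exact: specializes_cst.
  by apply: specializesM; [exact: specializes_cst | exact: specializes_varx].
have -> : rvar C = (rcst m1 * X + rcst m2) / (rcst m3 * X + rcst m4).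
  by rewrite -nw -[w]mul1r -(mulVf d0) -mulrA dw mulr1.
by apply: specializesM (lin m1 m2) _; apply: specializesV d0 (lin m3 m4).
Qed.

(** A linear combination of the three equations suffices, without differentiating them further. The
    definitions of g1, g2, g3 match the second order terms; the last three hypotheses match the
    coefficients of F_x, F_y and F. *)
Lemma follows_fully_F1 (a b1 b2 c : C) X Y tau e1 e0
    (g1 := D X ^+ 2 / (X * (1 - X))) (g2 := D Y ^+ 2 / (Y * (1 - Y)))
    (g3 := (2 * D X * D Y - g1 * (Y * (1 - X)) - g2 * (X * (1 - Y)))
           / (Y - X)) :
  specializes_to X Y tau (rvar C) ->
  X * (1 - X) != 0 -> Y * (1 - Y) != 0 -> Y - X != 0 ->
  D (D X) + e1 * D X =
    g1 * (rcst c - rcst (a + b1 + 1) * X) - g2 * (rcst b2 * X) + g3 * rcst b2 ->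
  D (D Y) + e1 * D Y =
    g2 * (rcst c - rcst (a + b2 + 1) * Y) - g1 * (rcst b1 * Y) - g3 * rcst b1 ->
  e0 = - (g1 * rcst (a * b1)) - g2 * rcst (a * b2) ->
  follows_fully (appellF1_system a b1 b2 c) X Y (ode2 1 e1 e0).
Proof.
move=> /specializes_surj lift X01 Y01 XY Ex Ey E0.
(* A multiplier of a PDE must be a function of x and y, whereas the g's are functions of t; the f's
   restrict to them on the curve. *)
have [f1 s1] := lift g1; have [f2 s2] := lift g2; have [f3 s3] := lift g3.
set H := appellF1_system a b1 b2 c.
have H0 : pde_follows H H`_0 by apply: PdeGen; rewrite mem_nth.
have H1 : pde_follows H H`_1 by apply: PdeGen; rewrite mem_nth.
have H2 : pde_follows H H`_2 by apply: PdeGen; rewrite mem_nth.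
exists (pde_scale f1 H`_0 + pde_scale f2 H`_1 + pde_scale f3 H`_2).
  apply: PdeAdd (PdeScale f3 H2).
  exact: PdeAdd (PdeScale f1 H0) (PdeScale f2 H1).
rewrite chain_rule_ode2 ?oner_neq0 // !mul1r Ex Ey E0.
have -> : D X ^+ 2 = g1 * (X * (1 - X)) by rewrite (divfK X01).
have -> : D Y ^+ 2 = g2 * (Y * (1 - Y)) by rewrite (divfK Y01).
have -> : 2 * D X * D Y =
    g1 * (Y * (1 - X)) + g2 * (X * (1 - Y)) + g3 * (Y - X).
  by rewrite (divfK XY) subrK_add.
rewrite /H /appellF1_system /pde_scale.
rewrite [nth _ _ 0]/= [nth _ _ 1]/= [nth _ _ 2]/=.
rewrite F1_combination => i j; rewrite !coef_jet2.
have [sx sy] := (specializes_varx X Y, specializes_vary X Y).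
have sc d := specializes_cst X Y d; have so := specializes1 X Y.
(* Both sides are now the same expression, in x, y and the f's on one side and in X, Y and the g's
   on the other; each of the six coefficients is specialized term by term. *)
by do 5?[apply: specializesD]; apply: specializesMb;
  repeat first [exact: s1 | exact: s2 | exact: s3 | exact: sx | exact: sy
    | exact: so | exact: sc | apply: specializesB | apply: specializesD
    | apply: specializesN | apply: specializesM].
Qed.

Lemma ode_of_F1_moebius theta (a b1 b2 c : C) X Y w p q l (m1 m2 m3 m4 : C) :
  dlog theta = l ->
  moebius (rcst m1) (rcst m2) (rcst m3) (rcst m4) X w (rvar C) ->
  F1_order2 D l (rcst a) (rcst b1) (rcst b2) (rcst c) X Y p q ->
  ode_of_F1 theta a b1 b2 c X Y (ode2 1 p q).
Proof.
move=> lE /(specializes_moebius Y)[tau st] [[X01 Y01 XY] [Ex Ey E0]].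
(* This is the equation of F itself, obtained by undoing the multiplication by theta. *)
exists (ode2 1 (p + 2 * l) (q + (p + 2 * l) * l - l ^+ 2 + D l)).
  apply: (follows_fully_F1 st X01 Y01 XY).
  - by rewrite !rcstE; exact: Ex.
  - by rewrite !rcstE; exact: Ey.
  - by rewrite !rcstE; exact: E0.
exists 1; first exact: oner_neq0.
rewrite scale1r (mul_solutions_ode2 _ _ _ (oner_neq0 _)) lE.
by rewrite mulr1 addrK mul1r addr_cancel4.
Qed.

End F1.

(** * Regular points and regular singularities *)

Section Regular.
Variables (C : fieldType) (alpha : C).
Implicit Types f g : ratfun C.

Lemma regular_tofrac (p : {poly C}) : regular_at alpha p%:F.
Proof. by exists p, 1; rewrite hornerC oner_neq0 tofrac1 divr1. Qed.

Lemma regular_cst c : regular_at alpha (rcst c).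
Proof. exact: regular_tofrac. Qed.

Lemma regularD f g : regular_at alpha f -> regular_at alpha g ->
  regular_at alpha (f + g).
Proof.
move=> [p [q [qa ->]]] [r [s [sa ->]]].
have q0 : q%:F != 0.
  by rewrite tofrac_eq0; apply: contraNneq qa => ->; rewrite horner0.
have s0 : s%:F != 0.
  by rewrite tofrac_eq0; apply: contraNneq sa => ->; rewrite horner0.
exists (p * s + r * q), (q * s); split.
  by rewrite hornerM (mulf_neq0 qa sa).
by rewrite (addf_div _ _ q0 s0) tofracD !tofracM.
Qed.

Lemma regularM f g : regular_at alpha f -> regular_at alpha g ->
  regular_at alpha (f * g).
Proof.
move=> [p [q [qa ->]]] [r [s [sa ->]]].
exists (p * r), (q * s); split.
  by rewrite hornerM (mulf_neq0 qa sa).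
by rewrite mulf_div !tofracM.
Qed.

Lemma regular_invB beta : alpha != beta ->
  regular_at alpha (rvar C - rcst beta)^-1.
Proof.
move=> ab; exists 1, ('X - beta%:P); split.
  by rewrite hornerXsubC subr_eq0.
by rewrite tofrac1 mul1r tofracB.
Qed.

(** If alpha = beta the quotient is 1; otherwise its denominator does not vanish at alpha. A simple
    pole at beta can thus be tested at every alpha uniformly. *)
Lemma regular_quotient beta :
  regular_at alpha ((rvar C - rcst alpha) / (rvar C - rcst beta)).
Proof.
have [<-|ab] := eqVneq alpha beta.
  by rewrite (mulfV (rvarB_neq0 _)) -tofrac1; exact: regular_tofrac.
apply: regularM (regular_invB ab); rewrite -tofracB; exact: regular_tofrac.
Qed.

Lemma regular_singular_ode2 (e2 e1 e0 : ratfun C) : e2 != 0 ->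
  regular_at alpha ((rvar C - rcst alpha) * (e1 / e2)) ->
  regular_at alpha ((rvar C - rcst alpha) ^+ 2 * (e0 / e2)) ->
  at_most_regular_singular alpha (ode2 e2 e1 e0).
Proof.
move=> e20 r1 r0 k.
rewrite (size_ode2 _ _ e20) (lead_coef_ode2 _ _ e20) coef_ode2.
case: k => [|[|[|//]]] _ /=.
- exact: r0.
- exact: r1.
- by rewrite subnn expr0 mul1r (mulfV e20) -tofrac1; exact: regular_tofrac.
Qed.

End Regular.

(** * Substitution of a nonconstant rational function *)

Section Composition.
Variables (C : numFieldType) (phi : ratfun C).
Hypothesis phi' : rderiv phi != 0.
Local Notation ev p := (map_poly (@rcst C) p).[phi].

Lemma rderiv_horner (p : {poly C}) : rderiv (ev p) = ev p^`() * rderiv phi.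
Proof.
elim/poly_ind: p => [|p c IHp].
  by rewrite deriv0 rmorph0 horner0 mul0r rderiv0.
rewrite derivD derivM derivX derivC addr0 mulr1 !rmorphD !rmorphM /=.
rewrite !map_polyX map_polyC !hornerD !hornerM !hornerX !hornerC.
rewrite rderivD rderivM IHp rderiv_cst addr0.
by rewrite mulrDl mulrAC.
Qed.

(** If p(phi) = 0, differentiation gives p'(phi) phi' = 0, hence p'(phi) = 0. By induction on the
    degree p' = 0, and in characteristic zero p is a constant, necessarily zero. *)
Lemma nonconstant_transcendental (p : {poly C}) : p != 0 -> ev p != 0.
Proof.
have [n] := ubnP (size p); elim: n p => [p|n IHn p sz p0].
  by move=> sz; exfalso; rewrite ltn0 in sz.
apply/negP => /eqP pphi.
have := rderiv_horner p; rewrite pphi rderiv0 => /esym/eqP.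
rewrite mulf_eq0 (negPf phi') orbF => /eqP dpphi.
have dp0 : p^`() = 0.
  apply/eqP; apply: contraT => dp0; have := IHn _ _ dp0.
  by rewrite dpphi eqxx; apply; exact: leq_trans (lt_size_deriv p0) sz.
have pC : p = (p`_0)%:P.
  apply/polyP => -[|i]; rewrite coefC //=.
  have := congr1 (fun r : {poly C} => r`_i) dp0.
  rewrite coef_deriv coef0 => /eqP.
  by rewrite mulrn_eq0 /= => /eqP.
move: p0 pphi; rewrite pC map_polyC hornerC polyC_eq0 => p0 /eqP.
by rewrite fmorph_eq0 (negPf p0).
Qed.

(** Transcendence of phi keeps both denominators nonzero after substitution, so the cross-multiplied
    equality of the two representations can be evaluated at phi. *)
Lemma rcomp_div (p q : {poly C}) : q != 0 ->
  rcomp phi (p%:F / q%:F) = ev p / ev q.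
Proof.
move=> q0; rewrite /rcomp; set f := p%:F / q%:F.
have m0 : \d_(repr f) != 0 := denom_ratioP _.
have e : \n_(repr f) * q = p * \d_(repr f).
  by apply/eqP; rewrite -(eq_fracE _ _ m0 q0); exact/eqP/esym/fracE.
have /eqP := congr1 (fun r => ev r) e; rewrite !rmorphM !hornerM.
rewrite -eqr_div; first by move/eqP.
  exact: nonconstant_transcendental.
exact: nonconstant_transcendental.
Qed.

Lemma rcomp_tofrac (p : {poly C}) : rcomp phi p%:F = ev p.
Proof.
have := rcomp_div p (oner_neq0 _).
by rewrite tofrac1 divr1 rmorph1 hornerC divr1.
Qed.

Lemma rcomp_cst c : rcomp phi (rcst c) = rcst c.
Proof. by rewrite rcomp_tofrac map_polyC hornerC. Qed.

Lemma rcomp_var : rcomp phi (rvar C) = phi.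
Proof. by rewrite rcomp_tofrac map_polyX hornerX. Qed.

Lemma rcompD f g : rcomp phi (f + g) = rcomp phi f + rcomp phi g.
Proof.
have [p [q [q0 ->]]] := fracP f; have [r [s [s0 ->]]] := fracP g.
have qF : q%:F != 0 by rewrite tofrac_eq0.
have sF : s%:F != 0 by rewrite tofrac_eq0.
have qe := nonconstant_transcendental q0.
have se := nonconstant_transcendental s0.
rewrite (addf_div _ _ qF sF) -!tofracM -tofracD !rcomp_div ?mulf_neq0 //.
by rewrite (addf_div _ _ qe se) rmorphD !rmorphM hornerD !hornerM.
Qed.

Lemma rcompM f g : rcomp phi (f * g) = rcomp phi f * rcomp phi g.
Proof.
have [p [q [q0 ->]]] := fracP f; have [r [s [s0 ->]]] := fracP g.
rewrite mulf_div -!tofracM (rcomp_div _ q0) (rcomp_div _ s0).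
rewrite (rcomp_div _ (mulf_neq0 q0 s0)).
by rewrite mulf_div !rmorphM !hornerM.
Qed.

Lemma rcompV f : rcomp phi f^-1 = (rcomp phi f)^-1.
Proof.
have [p [q [q0 ->]]] := fracP f.
have [->|p0] := eqVneq p 0.
  by rewrite tofrac0 mul0r invr0 -tofrac0 rcomp_tofrac rmorph0 horner0 invr0.
by rewrite invf_div (rcomp_div _ q0) (rcomp_div _ p0) invf_div.
Qed.

Lemma rcompN f : rcomp phi (- f) = - rcomp phi f.
Proof.
rewrite -mulN1r rcompM -tofrac1 -tofracN rcomp_tofrac.
by rewrite rmorphN1 hornerN hornerC mulN1r.
Qed.

Lemma rcomp1 : rcomp phi 1 = 1.
Proof. by rewrite -tofrac1 rcomp_tofrac rmorph1 hornerC. Qed.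

Lemma rcomp_nat n : rcomp phi n%:R = n%:R.
Proof. by rewrite -(rmorph_nat (@rcst C)) rcomp_cst. Qed.

Definition rcompE := (rcompD, rcompM, rcompV, rcompN, rcomp1, rcomp_nat,
  rcomp_cst, rcomp_var).

End Composition.

(** * Poles of the coefficients at finite points and at infinity *)

Section RegularIdentities.
Variables (K : fieldType) (D : K -> K) (a b x u : K).
Hypotheses (derD : derivation D) (Dx : D x = 1).
Hypotheses (x0 : x != 0) (xm : x - 1 != 0) (xp : x + 1 != 0).

(** With u = x - alpha, each fraction on the right is covered by [regular_quotient]; the division by
    1 is that by the leading coefficient. *)
Lemma ode_coef1_pole :
  u * (ode_coef1 a b x / 1) =
  (1 + b) * (u / x) + 2 * (a - b) * (u / (x + 1)) + 2 * a * (u / (x - 1)).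
Proof. by rewrite /ode_coef1; field; rewrite x0 xm xp oner_neq0. Qed.

Lemma ode_coef0_pole :
  u ^+ 2 * (ode_coef0 a b x / 1) =
  2 * a * (u / (x - 1)) * (b * (u / x) + 2 * (a - b) * (u / (x + 1))).
Proof. by rewrite /ode_coef0; field; rewrite ?x0 ?xm ?xp ?oner_neq0. Qed.

Lemma infinity_deriv (r := (D x^-1)^-1) :
  [/\ D x^-1 != 0, r = - x ^+ 2 & D r = - (2 * x)].
Proof.
have DV : D x^-1 = - x ^- 2 by rewrite (derivationV derD) Dx mulNr mul1r.
have rE : r = - x ^+ 2 by rewrite /r DV invrN invrK.
split; rewrite // ?DV ?oppr_eq0 ?invr_eq0 ?expf_neq0 //.
by rewrite rE (derivationN derD) (derivationX2 derD) Dx mulr1.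
Qed.

Lemma infinity_lead_neq0 : 1 * (- x ^+ 2) ^+ 2 != 0.
Proof. by rewrite mul1r sqrrN !expf_neq0. Qed.

(** The left side has the shape given by [pullback_ode2] for 1/x, with -2x in place of r' and the
    point 0 in place of alpha. On the right only inverses of x-1 and x+1 remain, and these are
    regular at 0. *)
Lemma ode_coef1_infinity (r := - x ^+ 2) :
  (x - 0) * ((ode_coef1 a b x^-1 * r + 1 * r * - (2 * x)) / (1 * r ^+ 2)) =
  (2 - (1 + b)) + - (2 * (a - b)) * (x + 1)^-1 + 2 * a * (x - 1)^-1.
Proof.
have xn : 1 - x != 0 by rewrite -oppr_eq0 opprB.
have xp' : 1 + x != 0 by rewrite addrC.
by rewrite /ode_coef1 /r; field;
  rewrite ?mulN1r ?oppr_eq0 ?expf_neq0 ?x0 ?xm ?xp ?xn ?xp' ?oner_neq0 //.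
Qed.

Lemma ode_coef0_infinity (r := - x ^+ 2) :
  (x - 0) ^+ 2 * (ode_coef0 a b x^-1 / (1 * r ^+ 2)) =
  - (2 * a) * (x - 1)^-1 * (b + 2 * (a - b) * (x + 1)^-1).
Proof.
have xn : 1 - x != 0 by rewrite -oppr_eq0 opprB.
have xp' : 1 + x != 0 by rewrite addrC.
by rewrite /ode_coef0 /r; field;
  rewrite ?mulN1r ?oppr_eq0 ?expf_neq0 ?x0 ?xm ?xp ?xn ?xp' ?oner_neq0 //.
Qed.

End RegularIdentities.

(** * The common equation and its ten origins *)

Section CommonOde.
Variables (C : numFieldType) (a b : C).
Local Notation x := (rvar C).
Local Notation D := (@rderiv C).
Let x0 : x != 0 := rvar_neq0 C.
Let xm : x - 1 != 0 := rvar_neq1 C.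
Let xp : x + 1 != 0 := rvar_neqN1 C.
Let dD : derivation D := rderiv_derivation C.
Let dx : D x = 1 := rderiv_var C.
Let da : D (rcst a) = 0 := rderiv_cst a.
Let db : D (rcst b) = 0 := rderiv_cst b.

Definition common_ode : ode C :=
  ode2 1 (ode_coef1 (rcst a) (rcst b) x) (ode_coef0 (rcst a) (rcst b) x).

Lemma common_ode_fuchsian : fuchsian common_ode.
Proof.
have n0 : 1 != 0 :> ratfun C := oner_neq0 _.
(* Each constant factor is gathered under one [rcst], the form handled by [regular_cst]. *)
have k1 : 1 + rcst b = rcst (1 + b) by rewrite rmorphD rmorph1.
have k2 : 2 * (rcst a - rcst b) = rcst (2 * (a - b)).
  by rewrite rmorphM rmorphB rmorph_nat.
have k3 : 2 * rcst a = rcst (2 * a) by rewrite rmorphM rmorph_nat.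
have k4 : 2 - rcst (1 + b) = rcst (2 - (1 + b)).
  by rewrite [in RHS]rmorphB rmorph_nat.
have rc := @regular_cst C.
split.
- by rewrite -size_poly_gt0 /common_ode (size_ode2 _ _ n0).
- move=> alpha.
  (* The finite poles of the coefficients can only be at 0, 1 and -1. *)
  have q0 := regular_quotient alpha 0; rewrite rmorph0 subr0 in q0.
  have q1 := regular_quotient alpha 1; rewrite rmorph1 in q1.
  have qm := regular_quotient alpha (-1); rewrite rmorphN1 opprK in qm.
  apply: (regular_singular_ode2 n0).
    rewrite (ode_coef1_pole _ _ _ x0 xm xp) k1 k2 k3.
    apply: regularD (regularM (rc _ _) q1).
    exact: regularD (regularM (rc _ _) q0) (regularM (rc _ _) qm).
  rewrite (ode_coef0_pole _ _ _ x0 xm xp) k2 k3.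
  apply: regularM (regularM (rc _ _) q1) _.
  exact: regularD (regularM (rc _ _) q0) (regularM (rc _ _) qm).
- have [d0 rE Dr] := infinity_deriv (rderiv_derivation C) (rderiv_var C) x0.
  rewrite /common_ode (pullback_ode2 _ _ _ n0) Dr rE.
  have i1 : regular_at 0 (x - 1)^-1.
    have := @regular_invB C 0 1; rewrite rmorph1; apply.
    by rewrite eq_sym oner_neq0.
  have im : regular_at 0 (x + 1)^-1.
    have := @regular_invB C 0 (-1); rewrite rmorphN1 opprK; apply.
    by rewrite eq_sym oppr_eq0 oner_neq0.
  have -> : rcomp x^-1 (ode_coef1 (rcst a) (rcst b) x) =
      ode_coef1 (rcst a) (rcst b) x^-1.
    by rewrite /ode_coef1 !(rcompE d0).
  have -> : rcomp x^-1 (ode_coef0 (rcst a) (rcst b) x) =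
      ode_coef0 (rcst a) (rcst b) x^-1.
    by rewrite /ode_coef0 !(rcompE d0).
  rewrite (rcomp1 d0).
  have e20 := infinity_lead_neq0 x0.
  apply: (regular_singular_ode2 e20); rewrite rmorph0.
    rewrite (ode_coef1_infinity _ _ x0 xm xp) k1 k2 k3 k4 -rmorphN.
    apply: regularD (regularM (rc _ _) i1).
    exact: regularD (rc _ _) (regularM (rc _ _) im).
  rewrite (ode_coef0_infinity _ _ x0 xm xp) k2 k3 -rmorphN.
  apply: regularM (regularM (rc _ _) i1) _.
  exact: regularD (rc _ _) (regularM (rc _ _) im).
Qed.

Lemma common_ode_2F1 :
  ode_of_2F1 [:: (1 - x, - (2 * a))] a (1 / 2) (1 + b)
    (- (4 * x / (x - 1) ^+ 2)) common_ode.
Proof.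
have two0 : 2 != 0 :> ratfun C.
  by rewrite -(rmorph_nat (@rcst C)) fmorph_eq0 pnatr_eq0.
have [z0 Dz0 e20 E1 E0] := euler_pullback (rcst b) (rderiv_derivation C)
  (rderiv_var C) (rderiv_cst a) x0 xm xp two0.
set z := - (4 * x / (x - 1) ^+ 2) in z0 Dz0 e20 E1 E0 *.
rewrite /ode_of_2F1.
have eE : euler_ode a (1 / 2) (1 + b) = ode2 (x * (1 - x))
   (1 + rcst b - (rcst a + 1 / 2 + 1) * x) (- (rcst a * (1 / 2))).
  have h1 : rcst (1 + b) = 1 + rcst b by rewrite rmorphD rmorph1.
  have h2 : rcst (a + 1 / 2 + 1) = rcst a + 1 / 2 + 1.
    by rewrite !rcstE.
  have h3 : rcst (a * (1 / 2)) = rcst a * (1 / 2) by rewrite !rcstE.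
  by rewrite /euler_ode /ode2 h1 h2 h3 polyCN.
have x10 := mulf_neq0 x0 (subr1_neq0 xm).
rewrite eE (pullback_ode2 _ _ _ x10).
have -> : rcomp z (x * (1 - x)) = z * (1 - z).
  by rewrite !(rcompE Dz0).
have -> : rcomp z (1 + rcst b - (rcst a + 1 / 2 + 1) * x) =
   1 + rcst b - (rcst a + 1 / 2 + 1) * z.
  by rewrite !(rcompE Dz0).
have -> : rcomp z (- (rcst a * (1 / 2))) = - (rcst a * (1 / 2)).
  by rewrite !(rcompE Dz0).
rewrite (mul_solutions_ode2 _ _ _ e20).
have -> : dlog [:: (1 - x, - (2 * a))] = - (2 * rcst a) * (D (1 - x) / (1 - x)).
  by rewrite /dlog big_cons big_nil addr0 !rcstE.
(* The factor of proportionality is the inverse of the leading coefficient. *)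
exists (z * (1 - z) * (D z)^-1 ^+ 2)^-1; first by rewrite invr_eq0 e20.
rewrite /common_ode E1 E0 scale_ode2 (mulVf e20).
reflexivity.
Qed.

Lemma dlog1 (f : ratfun C) e : dlog [:: (f, e)] = rcst e * (D f / f).
Proof. by rewrite /dlog big_cons big_nil addr0. Qed.

Lemma dlog2 (f g : ratfun C) e e' :
  dlog [:: (f, e); (g, e')] = rcst e * (D f / f) + rcst e' * (D g / g).
Proof. by rewrite /dlog !big_cons big_nil addr0. Qed.

Lemma common_ode_F1_X_X2 :
  ode_of_F1 [::]
    a (2 * b) (a - b) (1 + b) x (x ^+ 2) common_ode.
Proof.
(* The first 0 is the logarithmic derivative of theta = 1; the Moebius coefficients 1, 0, 0, 1
   express t = X. *)
apply: (@ode_of_F1_moebius _ _ _ _ _ _ _ _ _ _ _ 0 1 0 0 1).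
- exact: big_nil.
- by rewrite !rcstE; exact: (moebius_X x).
rewrite !rcstE.
exact: (F1_order2_X_X2 (rcst a) (rcst b) dD dx x0 xm xp).
Qed.

Lemma common_ode_F1_XdivXm1_NX :
  ode_of_F1 [:: (1 - x, - a)]
    a (1 - a) (a - b) (1 + b) (x / (x - 1)) (- x) common_ode.
Proof.
(* Solving X = t/(t-1) for t gives t = X/(X-1); the remaining curves are inverted in the same
   way. *)
apply: (@ode_of_F1_moebius _ _ _ _ _ _ _ _ _ _ _ _ 1 0 1 (-1)).
- exact: dlog1.
- by rewrite !rcstE; exact: (moebius_XdivXm1 xm).
rewrite !rcstE.
exact: (F1_order2_XdivXm1_NX (rcst b) dD dx da x0 xm xp).
Qed.

Lemma common_ode_F1_XdivXp1_X2divX2m1 :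
  ode_of_F1 [:: (1 - x ^+ 2, - a)]
    a (2 * b) (1 - a) (1 + b) (x / (x + 1)) (x ^+ 2 / (x ^+ 2 - 1)) common_ode.
Proof.
apply: (@ode_of_F1_moebius _ _ _ _ _ _ _ _ _ _ _ _ 1 0 (-1) 1).
- exact: dlog1.
- by rewrite !rcstE; exact: (moebius_XdivXp1 xp).
rewrite !rcstE.
exact: (F1_order2_XdivXp1_X2divX2m1 (rcst b) dD dx da x0 xm xp).
Qed.

Lemma common_ode_F1_1mX_1mX2 :
  ode_of_F1 [::]
    a (2 * b) (a - b) (2 * a) (1 - x) (1 - x ^+ 2) common_ode.
Proof.
apply: (@ode_of_F1_moebius _ _ _ _ _ _ _ _ _ _ _ 0 (-1) 1 0 1).
- exact: big_nil.
- by rewrite !rcstE; exact: (moebius_1mX x).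
rewrite !rcstE.
exact: (F1_order2_1mX_1mX2 (rcst a) (rcst b) dD dx x0 xm xp).
Qed.

Lemma common_ode_F1_Xm1divX_1mX :
  ode_of_F1 [:: (x, - a)]
    a (a - b) (a - b) (2 * a) ((x - 1) / x) (1 - x) common_ode.
Proof.
apply: (@ode_of_F1_moebius _ _ _ _ _ _ _ _ _ _ _ _ 0 1 (-1) 1).
- exact: dlog1.
- by rewrite !rcstE; exact: (moebius_Xm1divX x0).
rewrite !rcstE.
exact: (F1_order2_Xm1divX_1mX (rcst b) dD dx da x0 xm xp).
Qed.

Lemma common_ode_F1_Xinv_X :
  ode_of_F1 [:: (x, - a)]
    a (a - b) (a - b) (1 + a - 2 * b) (1 / x) x common_ode.
Proof.
apply: (@ode_of_F1_moebius _ _ _ _ _ _ _ _ _ _ _ _ 0 1 1 0).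
- exact: dlog1.
- by rewrite !rcstE; exact: (moebius_Xinv x0).
rewrite !rcstE.
exact: (F1_order2_Xinv_X (rcst b) dD dx da x0 xm xp).
Qed.

Lemma common_ode_F1_1mXinv_Xp1 :
  ode_of_F1 [:: (x - 1, - a)]
    a (1 - a) (a - b) (1 + a - 2 * b) (1 / (1 - x)) (x + 1) common_ode.
Proof.
apply: (@ode_of_F1_moebius _ _ _ _ _ _ _ _ _ _ _ _ 1 (-1) 1 0).
- exact: dlog1.
- by rewrite !rcstE; exact: (moebius_1mXinv xm).
rewrite !rcstE.
exact: (F1_order2_1mXinv_Xp1 (rcst b) dD dx da x0 xm xp).
Qed.

Lemma common_ode_F1_1mXinv_XdivXm1 :
  ode_of_F1 [:: (x, - b); (1 - x, 2 * b - 2 * a)]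
    (1 - 2 * b) (a - b) (a - b) (1 + a - 2 * b)
    (1 / (1 - x)) (x / (x - 1)) common_ode.
Proof.
apply: (@ode_of_F1_moebius _ _ _ _ _ _ _ _ _ _ _ _ 1 (-1) 1 0).
- exact: dlog2.
- by rewrite !rcstE; exact: (moebius_1mXinv xm).
rewrite !rcstE.
exact: (F1_order2_1mXinv_XdivXm1 dD dx da db x0 xm xp).
Qed.

Lemma common_ode_F1_Xp1_X :
  ode_of_F1 [:: (x, - b); (1 - x, 1 - 2 * a)]
    (1 - 2 * b) (a - b) (1 - a) (1 + a - 2 * b) (x + 1) x common_ode.
Proof.
apply: (@ode_of_F1_moebius _ _ _ _ _ _ _ _ _ _ _ _ 1 (-1) 0 1).
- exact: dlog2.
- by rewrite !rcstE; exact: (moebius_Xp1 x).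
rewrite !rcstE.
exact: (F1_order2_Xp1_X dD dx da db x0 xm xp).
Qed.

End CommonOde.

Theorem theorem5p2 (R : realType) (a b : R[i]) :
  let x : ratfun R[i] := rvar R[i] in
  exists E : ode R[i],
    [/\ size E = 3%N,
        fuchsian E,
        ode_of_F1 [::] a (2 * b) (a - b) (1 + b) x (x ^+ 2) E
      & ode_of_2F1 [:: (1 - x, - (2 * a))] a (1 / 2) (1 + b)
          (- (4 * x / (x - 1) ^+ 2)) E]
    /\
    [/\ ode_of_F1 [:: (1 - x, - a)]
          a (1 - a) (a - b) (1 + b) (x / (x - 1)) (- x) E,
        ode_of_F1 [:: (1 - x ^+ 2, - a)]
          a (2 * b) (1 - a) (1 + b) (x / (x + 1)) (x ^+ 2 / (x ^+ 2 - 1)) E,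
        ode_of_F1 [::]
          a (2 * b) (a - b) (2 * a) (1 - x) (1 - x ^+ 2) E
      & ode_of_F1 [:: (x, - a)]
          a (a - b) (a - b) (2 * a) ((x - 1) / x) (1 - x) E]
    /\
    [/\ ode_of_F1 [:: (x, - a)]
          a (a - b) (a - b) (1 + a - 2 * b) (1 / x) x E,
        ode_of_F1 [:: (x - 1, - a)]
          a (1 - a) (a - b) (1 + a - 2 * b) (1 / (1 - x)) (x + 1) E,
        ode_of_F1 [:: (x, - b); (1 - x, 2 * b - 2 * a)]
          (1 - 2 * b) (a - b) (a - b) (1 + a - 2 * b)
          (1 / (1 - x)) (x / (x - 1)) E
      & ode_of_F1 [:: (x, - b); (1 - x, 1 - 2 * a)]
          (1 - 2 * b) (a - b) (1 - a) (1 + a - 2 * b) (x + 1) x E].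
Proof.
move=> x; exists (common_ode a b).
have size3 : size (common_ode a b) = 3%N by apply: size_ode2; exact: oner_neq0.
split; [split | split; split].
- exact: size3.
- exact: common_ode_fuchsian.
- exact: common_ode_F1_X_X2.
- exact: common_ode_2F1.
- exact: common_ode_F1_XdivXm1_NX.
- exact: common_ode_F1_XdivXp1_X2divX2m1.
- exact: common_ode_F1_1mX_1mX2.
- exact: common_ode_F1_Xm1divX_1mX.
- exact: common_ode_F1_Xinv_X.
- exact: common_ode_F1_1mXinv_Xp1.
- exact: common_ode_F1_1mXinv_XdivXm1.
- exact: common_ode_F1_Xp1_X.
Qed.
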